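(* Let $\alpha,\zeta$ be parameters with $\Re(\alpha)>0$ and $\Re(\zeta)>-1$. Let $x_1$ and $x_2$ be statistically independently distributed real scalar positive random variables, where $x_1$ has the type-1 beta density with parameters $(\zeta+1,\alpha)$ and $x_2$ has an arbitrary density $f$ on $(0,\infty)$. Let $g$ denote the density of the product $u=x_1x_2$. Then the Kober fractional integral operator of the second kind applied to $f$, $$K_{u}^{\zeta,\alpha}f=\frac{u^{\zeta}}{\Gamma(\alpha)}\int_{u}^{\infty}(t-u)^{\alpha-1}t^{-\zeta-\alpha}f(t)\,dt,$$ is a constant multiple of $g$; that is, there is a constant $c$ (not depending on $u$) such that $K_{u}^{\zeta,\alpha}f=c\,g(u)$ for almost every $u>0$.
   Context: All densities are with respect to Lebesgue measure on $(0,\infty)$. The type-1 beta density with parameters $(\zeta+1,\alpha)$ is $$f_1(x)=\frac{\Gamma(\zeta+1+\alpha)}{\Gamma(\zeta+1)\Gamma(\alpha)}x^{\zeta}(1-x)^{\alpha-1},\quad 0<x<1,$$ and $f_1(x)=0$ elsewhere. In the statistical setting the parameters are real ($\alpha>0$, $\zeta>-1$), and then $g$ is the actual probability density of $x_1x_2$. For complex parameters, ''the density of $u=x_1x_2$'' means the function given by the usual formula $$g(u)=\int_{0}^{\infty}\frac{1}{v}f_1\left(\frac{u}{v}\right)f(v)\,dv,\quad u>0.$$ *)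

(* Defs.v *)
From HB Require Import structures.
From mathcomp Require Import all_boot all_order all_algebra.
From mathcomp Require Import all_classical all_reals all_analysis.
From mathcomp.real_closed Require Import complex.

Set Implicit Arguments.
Unset Strict Implicit.
Unset Printing Implicit Defensive.

Import Order.TTheory GRing.Theory Num.Theory.
Import numFieldNormedType.Exports.

Local Open Scope classical_set_scope.
Local Open Scope ring_scope.
Local Open Scope complex_scope.

Section ComplexFunctions.
Context {R : realType}.
Implicit Types (D : set R) (F : R -> R[i]) (z : R[i]).

Local Notation mu := (@lebesgue_measure R).

Definition cintegrable D F : Prop :=
  mu.-integrable D (fun x => (complex.Re (F x))%:E) /\
  mu.-integrable D (fun x => (complex.Im (F x))%:E).

Definition cintegral D F : R[i] :=
  (\int[mu]_(x in D) complex.Re (F x)) +i* (\int[mu]_(x in D) complex.Im (F x)).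

Definition cexp z : R[i] :=
  (expR (complex.Re z))%:C * (cos (complex.Im z) +i* sin (complex.Im z)).

(* Principal value; only meaningful for a base [t > 0]. *)
Definition cpow (t : R) z : R[i] := cexp (z * (ln t)%:C).

(* Euler's integral; only meaningful for [0 < Re z]. *)
Definition cGamma z : R[i] :=
  cintegral `]0, +oo[ (fun t => cpow t (z - 1) * (expR (- t))%:C).

(* Type-1 beta density with parameters [(zeta + 1, alpha)]. *)
Definition beta1_density (zeta alpha : R[i]) (x : R) : R[i] :=
  if 0 < x < 1 then
    cGamma (zeta + 1 + alpha) / (cGamma (zeta + 1) * cGamma alpha)
    * cpow x zeta * cpow (1 - x) (alpha - 1)
  else 0.

Definition product_integrand (zeta alpha : R[i]) (f : R -> R) (u v : R) : R[i] :=
  (v^-1)%:C * beta1_density zeta alpha (u / v) * (f v)%:C.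

Definition product_density (zeta alpha : R[i]) (f : R -> R) (u : R) : R[i] :=
  cintegral `]0, +oo[ (product_integrand zeta alpha f u).

Definition kober_integrand (zeta alpha : R[i]) (f : R -> R) (u t : R) : R[i] :=
  cpow (t - u) (alpha - 1) * cpow t (- zeta - alpha) * (f t)%:C.

Definition kober (zeta alpha : R[i]) (f : R -> R) (u : R) : R[i] :=
  cpow u zeta / cGamma alpha
  * cintegral `]u, +oo[ (kober_integrand zeta alpha f u).

End ComplexFunctions.

Section Densities.
Context {R : realType}.

Local Notation mu := (@lebesgue_measure R).

(* The values of [p] outside of [`]0, +oo[] are irrelevant. *)
Definition is_density (p : R -> R) : Prop :=
  [/\ measurable_fun (`]0, +oo[ : set R) p,
      (forall x, 0 < x -> 0 <= p x) &
      (\int[mu]_(x in `]0%R, +oo[) (p x)%:E = 1)%E].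

Context d (T : measurableType d) (P : probability T R).

(* In particular [X] is almost surely positive. *)
Definition has_density (X : T -> R) (p : R -> R) : Prop :=
  is_density p /\
  forall A : set R, measurable A ->
    (P (X @^-1` A) = \int[mu]_(x in A `&` `]0%R, +oo[) (p x)%:E)%E.

Definition independent_rv (X Y : T -> R) : Prop :=
  forall A B : set R, measurable A -> measurable B ->
    (P (X @^-1` A `&` Y @^-1` B) = P (X @^-1` A) * P (Y @^-1` B))%E.

End Densities.

(* Main.v *)
Require Import Defs.
From HB Require Import structures.
From mathcomp Require Import all_boot all_order all_algebra.
From mathcomp Require Import all_classical all_reals all_analysis.
From mathcomp.real_closed Require Import complex.
From mathcomp Require Import measurable_realfun ring lra.

Set Implicit Arguments.
Unset Strict Implicit.
Unset Printing Implicit Defensive.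

Import Order.TTheory GRing.Theory Num.Theory.
Import numFieldNormedType.Exports.

Local Open Scope classical_set_scope.
Local Open Scope ring_scope.
Local Open Scope complex_scope.

(** For [v > u] the integrand of the product density at [v] is
    [C u^zeta (v - u)^(alpha - 1) v^(- zeta - alpha) f v], where [C] is the
    normalizing constant of the beta density, and for [v <= u] it vanishes.
    Up to the factor [C u^zeta] it is therefore the integrand of the Kober
    operator, and the constant sought is
    [c = 1 / (Gamma(alpha) C) = Gamma(zeta + 1) / Gamma(zeta + 1 + alpha)]
    ([kober_product_density]).  Three points need an argument.

    Dividing by [C] requires that the complex Gamma function have no zero in the
    right half-plane ([cGamma_neq0]).  Suppose [Gamma(z) = 0] with [z = p + i y].  By the
    functional equation [Gamma(z + n) = 0] for all [n].  But
    [Gamma(a + i y) m^(- i y)] is the integral of [t^(a-1) e^-t] against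
    [exp(i y ln(t / m))], and for large [a] the probability density
    proportional to [t^(a-1) e^-t] concentrates, on a logarithmic scale, near
    [m = a - 1]: the second moment of [ln(t / m)] is at most [4 / (a - 1)].
    So the real part of [Gamma(a + i y) m^(- i y)] is at least
    [Gamma(a) (1 - 2 y^2 / (a - 1)) > 0], a contradiction.

    The integrals converge, in general, only for almost every [u].  Taking
    moduli reduces to real parameters, where the product density is a multiple
    of the multiplicative (Mellin) convolution of a beta kernel and [f].  By
    Tonelli and the scaling of Lebesgue measure the integral of such a
    convolution is the product of the integrals ([integral_mellin_conv]); both are finite, so the convolution is
    finite almost everywhere ([mellin_conv_beta_fin]).

    For real parameters, the same computation over a Borel set [B] instead of
    the whole half-line shows that the Mellin convolution of the densities of
    two independent variables is a density of their product ([product_law]),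
    and densities are unique almost everywhere ([density_product_ae]). *)

(** * Calculus on the positive half-line *)

Section Halfline.
Context {R : realType}.
Implicit Types (F h : R -> R) (t p : R).
Local Notation mu := (@lebesgue_measure R).

(* Compact intervals exhausting the half-line; with exponential end points
   [ln t] ranges over [-n, n], so powers of [t] decay geometrically at both
   ends. *)
Let window n : set R := `[expR (- n%:R), expR n%:R]%classic.

Let window_pos n t : window n t -> 0 < t.
Proof.
by rewrite /window /= in_itv/= => /andP[+ _]; exact: lt_le_trans (expR_gt0 _).
Qed.

Let window_subset n : window n `<=` `]0, +oo[%classic.
Proof. by move=> t /window_pos; rewrite /= in_itv/= andbT. Qed.

Let window_nondecreasing : {homo window : n m / (n <= m)%N >-> (n <= m)%O}.
Proof.
move=> n m nm; rewrite subsetEset => t.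
rewrite /window /= !in_itv/= => /andP[a b].
by rewrite (le_trans _ a) ?(le_trans b)// ler_expR ?lerN2 ler_nat.
Qed.

Let windowE n t : 0 < t -> window n t <-> `|ln t| <= n%:R.
Proof.
move=> t0; rewrite /window /= in_itv/= ler_norml.
by rewrite -[in expR _ <= t](lnK t0) -[in t <= expR _](lnK t0) !ler_expR.
Qed.

Let bigcup_window : \bigcup_n window n = `]0, +oo[%classic.
Proof.
apply/seteqP; split => [t [n _ /window_subset]//|t].
rewrite /= in_itv/= andbT => t0.
exists (Num.truncn `|ln t|).+1 => //; apply/windowE => //.
by apply: ltW; rewrite -Num.Theory.truncn_le_nat // ?leqnn.
Qed.

Let FTC_window F h n :
  (forall t, 0 < t -> is_derive t 1 F (h t)) ->
  (forall t, 0 < t -> {for t, continuous h}) ->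
  (\int[mu]_(t in window n) (h t)%:E =
    (F (expR n%:R))%:E - (F (expR (- n%:R)))%:E)%E.
Proof.
move=> dF ch.
case: n => [|n].
  by rewrite /window oppr0 set_itv1 integral_set1 -EFinB subrr.
have cF t : 0 < t -> {for t, continuous F}.
  move=> t0; apply: differentiable_continuous; apply/derivable1_diffP.
  by have [] := dF _ t0.
rewrite (@continuous_FTC2 _ h F)//.
- by rewrite ltr_expR gtrN.
- apply/continuous_within_itvP; first by rewrite ltr_expR gtrN.
  split.
  + move=> t; rewrite in_itv/= => /andP[+ _] => /(lt_trans (expR_gt0 _)).
    exact: ch.
  + by apply: cvg_at_right_filter; apply: ch; exact: expR_gt0.
  + by apply: cvg_at_left_filter; apply: ch; exact: expR_gt0.
- split.
  + move=> t; rewrite in_itv/= => /andP[+ _] => /(lt_trans (expR_gt0 _)) t0.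
    by have [] := dF _ t0.
  + by apply: cvg_at_right_filter; apply: cF; exact: expR_gt0.
  + by apply: cvg_at_left_filter; apply: cF; exact: expR_gt0.
- move=> t; rewrite in_itv/= => /andP[+ _] => /(lt_trans (expR_gt0 _)) t0.
  by rewrite derive1E; have [_] := dF _ t0.
Qed.

Lemma continuous_measurable_pos h :
  (forall t, 0 < t -> {for t, continuous h}) ->
  measurable_fun (`]0, +oo[ : set R) h.
Proof.
move=> ch; apply: open_continuous_measurable_fun; first exact: interval_open.
by move=> t; rewrite inE/= in_itv/= andbT; exact: ch.
Qed.

(** Monotone convergence along the windows bounds the integral by the
    oscillation of the antiderivative [F]. *)
Lemma ge0_derive_integrable_pos F h (M : R) :
  (forall t, 0 < t -> is_derive t 1 F (h t)) ->
  (forall t, 0 < t -> {for t, continuous h}) ->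
  (forall t, 0 < t -> 0 <= h t) ->
  (forall t, 0 < t -> 0 <= F t <= M) ->
  mu.-integrable `]0, +oo[ (EFin \o h).
Proof.
move=> dF ch h0 FM; have mh := continuous_measurable_pos ch.
apply/integrableP; split; first exact/measurable_EFinP.
under eq_integral => t.
  rewrite inE/= in_itv/= andbT => t0; rewrite /= ger0_norm ?h0//. over.
apply: (@le_lt_trans _ _ M%:E); last exact: ltry.
rewrite -bigcup_window.
have mhW n : measurable_fun (window n) (EFin \o h).
  by apply/measurable_EFinP; exact: measurable_funS (@window_subset n) mh.
have h0W n t : window n t -> (0 <= (EFin \o h) t)%E.
  by move=> /window_pos ?; rewrite lee_fin h0.
have mW n : measurable (window n) by exact: measurable_itv.
have cW : (\int[mu]_(t in window n) (h t)%:E @[n --> \oo] -->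
    \int[mu]_(t in \bigcup_n window n) (h t)%:E)%E.
  exact: ge0_nondecreasing_set_cvg_integral.
rewrite -(cvg_lim _ cW)//; apply: lime_le.
  apply: ereal_nondecreasing_is_cvgn.
  exact: ge0_nondecreasing_set_nondecreasing_integral.
apply: nearW => n; rewrite (FTC_window _ dF)// -EFinB lee_fin.
have /andP[a _] := FM _ (expR_gt0 (- n%:R)).
have /andP[_ b] := FM _ (expR_gt0 n%:R).
by lra.
Qed.

(** The boundary terms vanish: the bound on [F] says that it decays at least
    as fast as [t^(-d)] at [+oo] and as [t^d] at [0]. *)
Lemma Rintegral_derive_eq0 F h (C d : R) :
  (forall t, 0 < t -> is_derive t 1 F (h t)) ->
  (forall t, 0 < t -> {for t, continuous h}) ->
  mu.-integrable `]0, +oo[ (EFin \o h) ->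
  0 < d ->
  (forall t, 0 < t -> `|F t| <= C * expR (- d * `|ln t|)) ->
  \int[mu]_(t in `]0, +oo[) h t = 0.
Proof.
move=> dF ch ih d0 FC.
have mW n : measurable (window n) by exact: measurable_itv.
have mh := measurable_int _ ih.
pose hn n := (EFin \o h) \_ (window n).
have cW : (\int[mu]_(t in `]0%R, +oo[) hn n t @[n --> \oo] -->
    \int[mu]_(t in `]0%R, +oo[) (h t)%:E)%E.
  have [] // := @dominated_convergence _ _ _ mu _ (measurable_itv `]0%R, +oo[)
      hn (EFin \o h) (abse \o (EFin \o h)) _ mh.
  - move=> n; apply/measurable_restrict => //; first exact: mW.
    by apply: measurable_funS mh => //; exact: subIsetl.
  - apply: aeW => t /=; rewrite in_itv/= andbT => t0.
    apply: cvg_near_cst; exists (Num.truncn `|ln t|).+1 => // n /= nt.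
    rewrite /hn patchE mem_set//; apply/windowE => //.
    rewrite (le_trans _ (_ : (Num.truncn `|ln t|).+1%:R <= _)) ?ler_nat//.
    by apply: ltW; rewrite -Num.Theory.truncn_le_nat // ?leqnn.
  - exact: integrable_abse.
  - apply: aeW => t n _; rewrite /hn patchE; case: ifP => // _.
    by rewrite abse0 abse_ge0.
suff c0 : (\int[mu]_(t in `]0%R, +oo[) hn n t @[n --> \oo] --> 0)%E.
  by rewrite /Rintegral -(cvg_lim _ cW)// (cvg_lim _ c0).
under eq_fun => n.
  rewrite /hn -integral_mkcondr setIidr// (FTC_window _ dF)// -EFinB. over.
apply: cvg_EFin; first exact: nearW.
rewrite /=.
have q1 : `|expR (- d)| < 1 by rewrite ger0_norm ?expR_ge0// expR_lt1 oppr_lt0.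
have gq : 2 * C * expR (- d) ^+ n @[n --> \oo] --> (0 : R).
  by rewrite -[0 in X in _ --> X](mulr0 (2 * C)); apply: cvgMr; exact: cvg_expr.
apply/norm_cvg0P.
apply: (squeeze_cvgr _ (cvg_cst 0) gq).
apply: nearW => n; rewrite normr_ge0/= (le_trans (ler_normB _ _))//.
have := FC _ (expR_gt0 n%:R); have := FC _ (expR_gt0 (- n%:R)).
rewrite !expRK normrN normr_nat expRM_natr => a b.
rewrite (_ : 2 * C * _ = C * expR (- d) ^+ n + C * expR (- d) ^+ n).
  exact: lerD.
by lra.
Qed.

End Halfline.

(** * Real-valued integrable functions *)

Section RealIntegrable.
Context d (T : measurableType d) (R : realType).
Variables (mu : {measure set T -> \bar R}).
Variables (D : set T) (mD : measurable D).
Implicit Types f g : T -> R.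

Lemma integrableZl_EFin k f :
  mu.-integrable D (EFin \o f) -> mu.-integrable D (EFin \o (fun t => k * f t)).
Proof. by move=> /(integrableZl mD k); apply: eq_integrable. Qed.

Lemma integrableD_EFin f g :
  mu.-integrable D (EFin \o f) -> mu.-integrable D (EFin \o g) ->
  mu.-integrable D (EFin \o (fun t => f t + g t)).
Proof. by move=> mf mg; apply: eq_integrable (integrableD mD mf mg). Qed.

Lemma integrableB_EFin f g :
  mu.-integrable D (EFin \o f) -> mu.-integrable D (EFin \o g) ->
  mu.-integrable D (EFin \o (fun t => f t - g t)).
Proof. by move=> mf mg; apply: eq_integrable (integrableB mD mf mg). Qed.

Lemma RintegralB_lin f g h a b c :
  mu.-integrable D (EFin \o f) -> mu.-integrable D (EFin \o g) ->
  mu.-integrable D (EFin \o h) ->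
  \int[mu]_(t in D) (a * f t - (b * g t + c * h t)) =
  a * \int[mu]_(t in D) f t -
    (b * \int[mu]_(t in D) g t + c * \int[mu]_(t in D) h t).
Proof.
move=> intf intg inth.
have af := integrableZl_EFin a intf; have bg := integrableZl_EFin b intg.
have ch := integrableZl_EFin c inth.
rewrite (RintegralB mD af (integrableD_EFin bg ch)) (RintegralD mD bg ch).
by rewrite !RintegralZl.
Qed.

Lemma integrableB_lin f g h a b c :
  mu.-integrable D (EFin \o f) -> mu.-integrable D (EFin \o g) ->
  mu.-integrable D (EFin \o h) ->
  mu.-integrable D (EFin \o (fun t => a * f t - (b * g t + c * h t))).
Proof.
move=> intf intg inth; apply: integrableB_EFin; first exact: integrableZl_EFin.
by apply: integrableD_EFin; exact: integrableZl_EFin.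
Qed.

End RealIntegrable.

(** * Elementary inequalities *)

Section Inequalities.
Context {R : realType}.
Implicit Types q t x : R.

Lemma normr_sin_le x : `|sin x| <= `|x|.
Proof.
wlog x0 : x / 0 <= x.
  move=> H; have [/H //|x0] := leP 0 x.
  by have := H (- x); rewrite sinN !normrN; apply; rewrite oppr_ge0 ltW.
have [c _] : exists2 c, c \in `[0, x] & sin x - sin 0 = cos c * (x - 0).
  apply: MVT_segment => //; apply: continuous_subspaceT.
  exact: continuous_sin.
rewrite sin0 !subr0 => ->; rewrite normrM.
by rewrite ler_piMl// cos_max.
Qed.

Lemma cos_ge1B x : 1 - x ^+ 2 / 2 <= cos x.
Proof.
rewrite [in cos x](splitr x) cosD -!expr2 cos2sin2.
have : sin (x / 2) ^+ 2 <= (x / 2) ^+ 2.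
  rewrite -real_normK ?num_real// -[leRHS]real_normK ?num_real//.
  by rewrite lerXn2r ?nnegrE// normr_sin_le.
by lra.
Qed.

Lemma mulr_ln_le q t : 0 < q -> 0 < t -> q * ln t <= t + q * ln q.
Proof.
move=> q0 t0; have tq : 0 < t / q by rewrite divr_gt0.
have : ln (t / q) <= t / q.
  exact/ltW/ln_sublinear.
rewrite ln_div// => H.
have := ler_wpM2l (ltW q0) H; rewrite mulrBr [q * (t / q)]mulrC divfK ?gt_eqF//.
by lra.
Qed.

(** With [h = ln x / 2] the right-hand side is [4 (e^h - e^-h)^2], and
    [e^h - e^-h] dominates [h] in absolute value. *)
Lemma ln_sqr_le x : 0 < x -> ln x ^+ 2 <= 4 * (x + x^-1 - 2).
Proof.
move=> x0; set h := ln x / 2.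
have e : expR h * expR (- h) = 1 by rewrite -expRD subrr expR0.
have -> : x + x^-1 - 2 = (expR h - expR (- h)) ^+ 2.
  have -> : x = expR h ^+ 2 by rewrite -expRM_natl /h mulrC divfK// lnK.
  have -> : (expR h ^+ 2)^-1 = expR (- h) ^+ 2 by rewrite expRN exprVn.
  by rewrite sqrrB e; lra.
have -> : ln x = 2 * h by rewrite /h; lra.
have key (k : R) : 0 <= k -> k <= expR k - expR (- k).
  move=> k0; have := expR_ge1Dx k.
  by have : expR (- k) <= 1; [rewrite -expR0 ler_expR oppr_le0|lra].
have -> : (2 * h) ^+ 2 = 4 * h ^+ 2 by ring.
rewrite ler_pM2l//.
have [h0|h0] := leP 0 h.
  by rewrite lerXn2r ?nnegrE// ?key// (le_trans h0) ?key.
have h0' : 0 <= - h by lra.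
rewrite -sqrrN -[leRHS]sqrrN opprB.
have := key _ h0'; rewrite opprK => H.
by rewrite lerXn2r ?nnegrE// (le_trans h0').
Qed.

End Inequalities.

(** * Zeros of the Gamma function *)

Section GammaNonzero.
Context {R : realType}.
Implicit Types p y t theta : R.
Local Notation mu := (@lebesgue_measure R).

(** [t^(p-1) e^-t] for [t > 0], written as one exponential so that powers of
    [t] multiply by adding exponents. *)
Definition gamma_weight p t := expR ((p - 1) * ln t - t).

Lemma is_derive_expR_ln p c t : 0 < t ->
  is_derive t 1 (fun t => expR (p * ln t - c * t))
    ((p / t - c) * expR (p * ln t - c * t)).
Proof.
move=> t0.
have ? := is_derive1_ln t0.
have D : is_derive t 1 (fun t => p * ln t - c * t) (p / t - c).
  by apply: is_derive_eq; rewrite /GRing.scale/= mulr1.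
have := @is_derive1_comp _ expR (fun t => p * ln t - c * t) t _ _
  (is_derive_expR _) D.
by rewrite mulrC.
Qed.

Lemma continuous_expR_ln p c t : 0 < t ->
  {for t, continuous (fun t => expR (p * ln t - c * t))}.
Proof.
move=> t0; apply: differentiable_continuous; apply/derivable1_diffP.
by have [] := is_derive_expR_ln p c t0.
Qed.

Lemma gamma_weightE p :
  gamma_weight p = (fun t => expR ((p - 1) * ln t - 1 * t)).
Proof. by apply/funext => t; rewrite /gamma_weight mul1r. Qed.

Lemma gamma_weight_gt0 p t : 0 < gamma_weight p t.
Proof. exact: expR_gt0. Qed.

Lemma gamma_weightS p t :
  0 < t -> gamma_weight (p + 1) t = t * gamma_weight p t.
Proof.
by move=> t0; rewrite -{2}(lnK t0) /gamma_weight -expRD; congr expR; ring.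
Qed.

Lemma continuous_gamma_weight p t :
  0 < t -> {for t, continuous (gamma_weight p)}.
Proof. by rewrite gamma_weightE; exact: continuous_expR_ln. Qed.

(** The derivative of the bounded function [t^p / (1 + t^p)].  It is integrable
    on the half-line and comparable to [t^(p-1)] near [0]. *)
Definition pow_dominator p t :=
  p * expR ((p - 1) * ln t) * (1 + expR (p * ln t)) ^- 2.

Lemma pow_dominator_integrable p : 0 < p ->
  mu.-integrable `]0, +oo[ (EFin \o pow_dominator p).
Proof.
move=> p0.
pose s t := expR (p * ln t - 0 * t).
have s1 t : 0 < 1 + s t by rewrite addr_gt0// expR_gt0.
pose h t := p * expR ((p - 1) * ln t - 0 * t) * (1 + s t) ^- 2.
have -> : pow_dominator p = h.
  by apply/funext => t; rewrite /h /s /pow_dominator !mul0r !subr0.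
apply: (@ge0_derive_integrable_pos _ (fun t => 1 - (1 + s t)^-1) h 1) => t t0.
- have ds := is_derive_expR_ln p 0 t0.
  have d1 : is_derive t 1 (fun t => 1 + s t) ((p / t - 0) * s t).
    by apply: is_derive_eq; rewrite add0r mul1r.
  have n0 : 1 + s t != 0 by rewrite gt_eqF.
  have d2 := @is_deriveV _ (fun t => 1 + s t) _ _ _ n0 d1.
  apply: is_derive_eq; rewrite /GRing.scale/= /h mulNr opprK -/(s t).
  rewrite add0r mul1r mulrC; congr (_ * _).
  rewrite subr0 -mulrA /s; congr (_ * _).
  by rewrite -[t in t^-1](lnK t0) -expRN -expRD; congr expR; ring.
- rewrite /h; apply: continuousM.
    by apply: continuousM; [exact: cst_continuous|exact: continuous_expR_ln].
  apply: continuousV; first by rewrite expf_neq0// gt_eqF// s1.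
  by apply: (@continuousM _ _ (fun t => 1 + s t) (fun t => 1 + s t));
    apply: continuousD; by [exact: cst_continuous|exact: continuous_expR_ln].
- by rewrite /h !mulr_ge0 ?invr_ge0 ?exprn_ge0 ?expR_ge0 ?(ltW (s1 _)) ?ltW.
- have : 0 < (1 + s t)^-1 <= 1.
    by rewrite invr_gt0 s1/= invf_le1// lerDl expR_ge0.
  by lra.
Qed.

(** Dominated by a multiple of [pow_dominator p], because [e^-t (1 + t^p)^2] is
    bounded: split [e^-t] as a square and use [t^p e^(-t/2) <= (2p)^p]. *)
Lemma gamma_weight_integrable p : 0 < p ->
  mu.-integrable `]0, +oo[ (EFin \o gamma_weight p).
Proof.
move=> p0.
pose C := p^-1 * (1 + expR (p * ln (2 * p))) ^+ 2.
have mw : measurable_fun (`]0, +oo[ : set R) (gamma_weight p).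
  by apply: continuous_measurable_pos => t; exact: continuous_gamma_weight.
have := @integrableZl _ _ _ mu _ (measurable_itv `]0%R, +oo[) C _
  (pow_dominator_integrable p0).
apply: le_integrable => //; first exact/measurable_EFinP.
move=> t; rewrite /= in_itv/= andbT => t0; rewrite lee_fin.
rewrite ger0_norm ?(ltW (gamma_weight_gt0 _ _))// (le_trans _ (ler_norm _))//.
rewrite /C /pow_dominator.
set s := expR (p * ln t).
have s0 : 0 < 1 + s by rewrite addr_gt0// expR_gt0.
have -> : gamma_weight p t = expR ((p - 1) * ln t) * expR (- (t / 2)) ^+ 2.
  by rewrite /gamma_weight -expRM_natl -expRD; congr expR; lra.
rewrite [leRHS](_ : _ = expR ((p - 1) * ln t) *
   ((1 + expR (p * ln (2 * p))) / (1 + s)) ^+ 2); last first.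
  by field; rewrite !gt_eqF.
rewrite ler_pM2l ?expR_gt0// lerXn2r ?nnegrE ?expR_ge0//.
  by rewrite divr_ge0 ?ltW// addr_gt0// expR_gt0.
rewrite ler_pdivlMr// mulrDr mulr1 lerD//.
  by rewrite -[leRHS]expR0 ler_expR; lra.
rewrite -expRD ler_expR.
have p20 : 0 < 2 * p by lra.
by have := mulr_ln_le p20 t0; lra.
Qed.

(** The real part of [e^(i theta) t^(p - 1 + i y) e^-t].  A free phase [theta]
    treats real and imaginary parts at once and absorbs the factor [m^(- i y)]
    of the concentration argument. *)
Definition gamma_phase p y theta t := gamma_weight p t * cos (y * ln t + theta).

Lemma continuous_gamma_phase p y theta t : 0 < t ->
  {for t, continuous (gamma_phase p y theta)}.
Proof.
move=> t0; apply: continuousM; first exact: continuous_gamma_weight.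
apply: (@continuous_comp _ _ _ (fun t => y * ln t + theta) cos); last first.
  exact: continuous_cos.
apply: continuousD; last exact: cst_continuous.
by apply: continuousM; [exact: cst_continuous|exact: continuous_ln].
Qed.

Lemma gamma_phase_integrable p y theta : 0 < p ->
  mu.-integrable `]0, +oo[ (EFin \o gamma_phase p y theta).
Proof.
move=> p0; apply: le_integrable (gamma_weight_integrable p0) => //.
  apply/measurable_EFinP; apply: continuous_measurable_pos => t.
  exact: continuous_gamma_phase.
move=> t _ /=; rewrite lee_fin normrM ler_piMr// cos_max//.
Qed.

Definition gamma_phase_int p y theta :=
  \int[mu]_(t in `]0, +oo[) gamma_phase p y theta t.

(** The functional equation of Gamma at [p + i y], in the direction [theta]:
    multiplication by [i] is a shift of the phase by a quarter turn. *)
Lemma gamma_phase_intS p y theta : 0 < p ->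
  gamma_phase_int (p + 1) y theta =
  p * gamma_phase_int p y theta + y * gamma_phase_int p y (theta + pi / 2).
Proof.
move=> p0.
have p10 : 0 < p + 1 by lra.
have i1 := gamma_phase_integrable y theta p0.
have i2 := gamma_phase_integrable y theta p10.
have i3 := gamma_phase_integrable y (theta + pi / 2) p0.
have m0 := measurable_itv `]0%R, +oo[ : measurable (`]0, +oo[ : set R).
pose h t := p * gamma_phase p y theta t + y * gamma_phase p y (theta + pi / 2) t
  - gamma_phase (p + 1) y theta t.
have j1 : mu.-integrable `]0, +oo[
    (EFin \o (fun t => p * gamma_phase p y theta t)).
  exact: integrableZl_EFin.
have j3 : mu.-integrable `]0, +oo[
    (EFin \o (fun t => y * gamma_phase p y (theta + pi / 2) t)).
  exact: integrableZl_EFin.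
have j13 : mu.-integrable `]0, +oo[
    (EFin \o (fun t => p * gamma_phase p y theta t +
      y * gamma_phase p y (theta + pi / 2) t)).
  exact: integrableD_EFin.
have : \int[mu]_(t in `]0, +oo[) h t = 0.
  (* [h] is the derivative of [t^p e^-t cos(y ln t + theta)], which decays like
     [t^p] at [0] and, as [2p ln t <= t + 2p ln (2p)], like [t^(-p)] at [+oo] *)
  apply: (@Rintegral_derive_eq0 _ (gamma_phase (p + 1) y theta) h
    (expR (2 * p * ln (2 * p) + 1)) p _ _ _ p0).
  - move=> t t0.
    have dw := is_derive_expR_ln (p + 1 - 1) 1 t0; rewrite -gamma_weightE in dw.
    have dl := is_derive1_ln t0.
    have da : is_derive t 1 (fun t => y * ln t + theta) (y / t).
      by apply: is_derive_eq; rewrite addr0.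
    have dc := @is_derive1_comp _ cos (fun t => y * ln t + theta) t _ _
      (is_derive_cos _) da.
    have := is_deriveM dw dc.
    rewrite /GRing.scale/= => D; apply: is_derive_eq D _.
    rewrite /h /gamma_phase addrA cosDpihalf gamma_weightS// !addrK.
    rewrite -[expR (p * ln t - 1 * t)]/((fun u => expR (p * ln u - 1 * u)) t).
    have -> : expR (p * ln t - 1 * t) = t * gamma_weight p t.
      by rewrite -gamma_weightS// gamma_weightE addrK.
    by field; rewrite gt_eqF.
  - move=> t t0; apply: continuousB; last exact: continuous_gamma_phase.
    by apply: continuousD; apply: continuousM;
      by [exact: cst_continuous|exact: continuous_gamma_phase].
  - exact: integrableB_EFin.
  - move=> t t0; rewrite normrM.
    rewrite ger0_norm ?(ltW (gamma_weight_gt0 _ _))//.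
    rewrite (@le_trans _ _ (gamma_weight (p + 1) t))//.
      by rewrite ler_piMr// ?cos_max// ltW// gamma_weight_gt0.
    rewrite /gamma_weight -expRD ler_expR addrK.
    have p20 : 0 < 2 * p by lra.
    have e2 := mulr_ln_le p20 t0.
    have e3 := mulr_ln_le p20 ltr01; rewrite ln1 mulr0 in e3.
    have [l0|l0] := leP 0 (ln t).
      by rewrite ger0_norm//; lra.
    by rewrite ltr0_norm//; lra.
rewrite RintegralB// RintegralD// !RintegralZl// => /eqP.
by rewrite subr_eq0 => /eqP/esym.
Qed.

Lemma gamma_phase00 p : gamma_phase p 0 0 = gamma_weight p.
Proof. by apply/funext => t; rewrite /gamma_phase mul0r addr0 cos0 mulr1. Qed.

Lemma gamma_weight_intS p : 0 < p ->
  \int[mu]_(t in `]0, +oo[) gamma_weight (p + 1) t =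
  p * \int[mu]_(t in `]0, +oo[) gamma_weight p t.
Proof.
move=> /(gamma_phase_intS 0 0).
by rewrite mul0r addr0 /gamma_phase_int !gamma_phase00.
Qed.

Lemma gamma_weight_int_gt0 p :
  0 < p -> 0 < \int[mu]_(t in `]0, +oo[) gamma_weight p t.
Proof.
move=> p0; have iw := gamma_weight_integrable p0.
have m0 : measurable (`]0, +oo[ : set R) by exact: measurable_itv.
rewrite lt_neqAle Rintegral_ge0 ?andbT; last first.
  by move=> t _; exact/ltW/gamma_weight_gt0.
apply/eqP => /esym I0.
have : (\int[mu]_(t in `]0%R, +oo[) `|(gamma_weight p t)%:E| = 0)%E.
  transitivity (\int[mu]_(t in `]0%R, +oo[) (gamma_weight p t)%:E)%E.
    apply: eq_integral => t _.
    by rewrite gee0_abs// lee_fin ltW// gamma_weight_gt0.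
  by rewrite -[LHS]fineK ?[fine _]I0//; exact: integrable_fin_num.
have mw := measurable_int _ iw.
move/ae_eq_integral_abs => /(_ m0 mw) [N [mN N0 sN]].
have : (mu `]0%R, +oo[ <= mu N)%E.
  apply: le_measure; rewrite ?inE//.
  move=> t /= t0; apply: sN => /= /(_ t0) [] /eqP.
  by rewrite gt_eqF// gamma_weight_gt0.
by rewrite [X in (_ <= X)%E]N0 lebesgue_measure_itv/= lt0y.
Qed.

(** The heart of the non-vanishing of Gamma: if all phases vanished at [p],
    they would vanish at [p + n] for all [n], while for large [n] the weight at
    [p + n = m + 1] is so concentrated around [m] that the phase
    [- y ln m] gives a positive integral. *)
Lemma gamma_phase_int_neq0 p y : 0 < p ->
  exists theta, gamma_phase_int p y theta != 0.
Proof.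
move=> p0; apply: contrapT => H0.
have {}H0 theta : gamma_phase_int p y theta = 0.
  by apply/eqP/negPn/negP => H; apply: H0; exists theta.
have Hn n theta : gamma_phase_int (p + n%:R) y theta = 0.
  elim: n theta => [|n IH] theta; first by rewrite addr0.
  rewrite -natr1 addrA gamma_phase_intS ?IH; first by rewrite !mulr0 addr0.
  by rewrite ltr_wpDr.
pose n := (Num.truncn (2 * y ^+ 2)).+2.
have y0 : 0 <= y ^+ 2 by exact: sqr_ge0.
pose m := p + n%:R - 1.
have ymlt : 2 * y ^+ 2 < m.
  have : 2 * y ^+ 2 < (Num.truncn (2 * y ^+ 2)).+1%:R.
    by rewrite -Num.Theory.truncn_le_nat // ?leqnn.
  by rewrite /m /n -[in X in _ -> X]natr1; lra.
have m0 : 0 < m by lra.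
have m10 : 0 < m + 1 by lra.
have m20 : 0 < m + 1 + 1 by lra.
have mE : p + n%:R = m + 1 by rewrite /m; ring.
(* a lower bound of the integrand, from [cos x >= 1 - x^2 / 2] and [ln_sqr_le]
   at [t / m]; its integral is computed by the functional equation *)
pose L t := (1 + 4 * y ^+ 2) * gamma_weight (m + 1) t -
  ((2 * y ^+ 2 / m) * gamma_weight (m + 1 + 1) t +
   (2 * y ^+ 2 * m) * gamma_weight m t).
have mD : measurable (`]0, +oo[ : set R) by exact: measurable_itv.
have i0 := gamma_weight_integrable m0.
have i1 := gamma_weight_integrable m10.
have i2 := gamma_weight_integrable m20.
pose G := \int[mu]_(t in `]0, +oo[) gamma_weight m t.
have G0 : 0 < G by exact: gamma_weight_int_gt0.
have IL : \int[mu]_(t in `]0, +oo[) L t = (m - 2 * y ^+ 2) * G.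
  pose I q := \int[mu]_(t in `]0, +oo[) gamma_weight q t.
  transitivity ((1 + 4 * y ^+ 2) * I (m + 1) -
      ((2 * y ^+ 2 / m) * I (m + 1 + 1) + (2 * y ^+ 2 * m) * I m)).
    apply: RintegralB_lin; [exact: mD|exact: i1|exact: i2|exact: i0].
  rewrite /I (gamma_weight_intS m10) (gamma_weight_intS m0) -/G.
  by field; rewrite gt_eqF.
have : \int[mu]_(t in `]0, +oo[) L t <=
    gamma_phase_int (m + 1) y (- (y * ln m)).
  have jp := gamma_phase_integrable y (- (y * ln m)) m10.
  apply: le_Rintegral.
  - exact: mD.
  - apply: integrableB_lin; [exact: mD|exact: i1|exact: i2|exact: i0].
  - exact: jp.
  move=> t; rewrite /= in_itv/= andbT => t0.
  have tm : 0 < t / m by rewrite divr_gt0.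
  rewrite /L /gamma_phase !gamma_weightS//.
  have -> : y * ln t + - (y * ln m) = y * ln (t / m) by rewrite ln_div//; ring.
  rewrite (_ : _ - _ = t * gamma_weight m t *
    (1 - y ^+ 2 * (4 * (t / m + (t / m)^-1 - 2)) / 2)); last first.
    by field; rewrite !gt_eqF.
  rewrite ler_pM2l ?mulr_gt0 ?gamma_weight_gt0//.
  apply: le_trans (cos_ge1B _); rewrite lerB// ler_pM2r ?invr_gt0// exprMn.
  by rewrite ler_wpM2l// ln_sqr_le.
by rewrite IL -mE Hn; apply/negP; rewrite -ltNge mulr_gt0// subr_gt0.
Qed.

End GammaNonzero.

Section ComplexPowers.
Context {R : realType}.
Implicit Types (z w : R[i]) (t : R).
Local Notation mu := (@lebesgue_measure R).

Lemma cpowE t z : cpow t z =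
  (expR (complex.Re z * ln t) * cos (complex.Im z * ln t)) +i*
  (expR (complex.Re z * ln t) * sin (complex.Im z * ln t)).
Proof.
case: z => a b; rewrite /cpow /cexp; simpc; rewrite /=.
by congr (_ +i* _); rewrite !mulr0 ?subr0 ?add0r.
Qed.

Lemma cexpD z w : cexp (z + w) = cexp z * cexp w.
Proof.
case: z => a b; case: w => c d; rewrite /cexp; simpc.
rewrite /= expRD cosD sinD.
by congr (_ +i* _); ring.
Qed.

Lemma cexp0 : cexp 0 = 1 :> R[i].
Proof. by rewrite /cexp /= expR0 cos0 sin0; simpc. Qed.

Lemma cexp_neq0 z : cexp z != 0.
Proof.
apply/eqP => z0; have := cexpD z (- z); rewrite subrr cexp0 z0 mul0r => /eqP.
by rewrite oner_eq0.
Qed.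

Lemma cpowD t z w : cpow t (z + w) = cpow t z * cpow t w.
Proof. by rewrite /cpow mulrDl cexpD. Qed.

Lemma cpow_neq0 t z : cpow t z != 0.
Proof. exact: cexp_neq0. Qed.

Lemma cpowN t z : cpow t (- z) = (cpow t z)^-1.
Proof.
apply: (mulIf (cpow_neq0 t z)); rewrite mulVf ?cpow_neq0// -cpowD addNr.
by rewrite /cpow mul0r cexp0.
Qed.

Lemma cpow1 t : 0 < t -> cpow t 1 = t%:C.
Proof.
by move=> t0; rewrite cpowE /= mul1r mul0r lnK// cos0 sin0 mulr1 mulr0.
Qed.

Lemma cpowM s t z : 0 < s -> 0 < t -> cpow (s * t) z = cpow s z * cpow t z.
Proof. by move=> s0 t0; rewrite /cpow lnM// rmorphD mulrDr cexpD. Qed.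

Lemma cpowV t z : 0 < t -> cpow t^-1 z = (cpow t z)^-1.
Proof. by move=> t0; rewrite -cpowN /cpow lnV// rmorphN mulrN mulNr. Qed.

Lemma cGammaE z : cGamma z =
  gamma_phase_int (complex.Re z) (complex.Im z) 0 +i*
  gamma_phase_int (complex.Re z) (complex.Im z) (- (pi / 2)).
Proof.
rewrite /cGamma /cintegral; congr (_ +i* _); apply: eq_Rintegral => t _;
  case: z => a b; rewrite cpowE; simpc;
  rewrite /= /gamma_phase /gamma_weight expRD.
- by rewrite addr0 mulrAC.
- rewrite cosD cosN sinN cos_pihalf sin_pihalf.
  by rewrite mulr0 mulrN1 opprK add0r mulrAC.
Qed.

Lemma gamma_phase_int_lin (p y theta : R) : 0 < p ->
  gamma_phase_int p y theta = cos theta * gamma_phase_int p y 0 -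
    sin theta * gamma_phase_int p y (- (pi / 2)).
Proof.
move=> p0; have mD : measurable (`]0, +oo[ : set R) by exact: measurable_itv.
have i1 := gamma_phase_integrable y 0 p0.
have i2 := gamma_phase_integrable y (- (pi / 2)) p0.
transitivity (cos theta * gamma_phase_int p y 0 -
    (sin theta * gamma_phase_int p y (- (pi / 2)) +
     0 * gamma_phase_int p y (- (pi / 2)))); last by rewrite mul0r addr0.
rewrite /gamma_phase_int.
transitivity (\int[mu]_(t in `]0, +oo[) (cos theta * gamma_phase p y 0 t -
    (sin theta * gamma_phase p y (- (pi / 2)) t +
     0 * gamma_phase p y (- (pi / 2)) t))).
  apply: eq_Rintegral => t _; rewrite /gamma_phase !cosD sinN cosN.
  by rewrite cos_pihalf sin_pihalf cos0 sin0; ring.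
by apply: RintegralB_lin; [exact: mD|exact: i1|exact: i2|exact: i2].
Qed.

Lemma cGamma_neq0 z : 0 < complex.Re z -> cGamma z != 0.
Proof.
move=> z0; have [theta] := gamma_phase_int_neq0 (complex.Im z) z0.
apply: contra_neqN => /eqP; rewrite cGammaE => -[r0 i0].
by rewrite gamma_phase_int_lin// r0 i0 !mulr0 subr0.
Qed.

End ComplexPowers.

(** * Multiplicative convolution on the half-line *)

Section MellinConvolution.
Context {R : realType}.
Local Notation mu := (@lebesgue_measure R).
Local Notation RL := (measurableTypeR R).
Local Notation pos := (`]0%R, +oo[%classic : set RL).

Let scale (v : R) : RL -> RL := fun x => x * v.

Let measurable_scale (v : R) : measurable_fun [set: RL] (scale v).
Proof. by apply: measurable_funM. Qed.

Lemma lebesgue_measure_scale (v : R) (v0 : 0 < v) (A : set RL) : measurable A ->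
  mu A = pushforward (mscale (NngNum (ltW v0)) mu) (scale v) A.
Proof.
apply: lebesgue_measure_unique => // X [[a b] _ <-] /=.
rewrite /pushforward /mscale/=.
have -> : scale v @^-1` `]a, b] = `](a / v), (b / v)]%classic.
  apply/seteqP; split => x;
    by rewrite /scale /= !in_itv/= ltr_pdivrMr// ler_pdivlMr.
rewrite [X in (X = _)%E]lebesgue_measure_itv.
rewrite [X in (_ = _ * X)%E]lebesgue_measure_itv/=.
rewrite !lte_fin ltr_pM2r ?invr_gt0//.
case: ifPn => _; last by rewrite mule0.
by rewrite -!EFinB -EFinM; congr EFin; field; rewrite gt_eqF.
Qed.

Lemma ge0_integral_scale (v : R) (D : set RL) (h : RL -> \bar R) : 0 < v ->
  measurable D -> measurable_fun D h -> (forall u, D u -> 0 <= h u)%E ->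
  (\int[mu]_(u in D) h u =
   v%:E * \int[mu]_(x in [set x | D (x * v)%R]) h (x * v)%R)%E.
Proof.
move=> v0 mD mh h0.
have mD' : measurable (scale v @^-1` D).
  by rewrite -[X in measurable X]setTI; exact: measurable_scale.
pose mu_v := pushforward (mscale (NngNum (ltW v0)) mu) (scale v).
transitivity (\int[mu_v]_(u in D) h u)%E.
  by apply: eq_measure_integral => // A mA _; exact: lebesgue_measure_scale.
rewrite ge0_integral_pushforward//; last by move=> u /set_mem; exact: h0.
rewrite ge0_integral_mscale//=.
- apply: (measurable_comp mD _ mh); last exact: measurable_funTS.
  by move=> _ [x Dx <-].
- by move=> x Dx; exact: h0.
Qed.

Variables (phi f : R -> R).
Hypotheses (mphi : measurable_fun [set: R] phi).
Hypotheses (mf : measurable_fun [set: R] f).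
Hypotheses (phi0 : forall x, 0 <= phi x) (f0 : forall x, 0 <= f x).

(* The convolution kernel on the plane; [expR (- ln v)] is [v^-1] for [v > 0]
   and is measurable in [v] as a composition. *)
Let K (B : set RL) (z : RL * RL) : \bar R :=
  (\1_(B `&` pos) z.1 * (\1_pos z.2 *
    (expR (- ln z.2) * phi (z.1 * expR (- ln z.2)) * f z.2)))%:E.

Let mK B : measurable B -> measurable_fun [set: RL * RL] (K B).
Proof.
move=> mB; apply/measurable_EFinP; apply: measurable_funM.
  apply: measurableT_comp => //.
  by apply: measurable_indic; exact: measurableI.
apply: measurable_funM.
  apply: measurableT_comp => //.
have ml : measurable_fun [set: RL * RL] (fun z => expR (- ln z.2)).
  apply: measurableT_comp => //; apply: measurableT_comp => //.
  exact: measurableT_comp.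
apply: measurable_funM; last exact: measurableT_comp.
apply: measurable_funM => //.
by apply: measurableT_comp => //; apply: measurable_funM.
Qed.

Let K0 B z : (0 <= K B z)%E.
Proof. by rewrite lee_fin !mulr_ge0 ?expR_ge0// indicE ler0n. Qed.

(** The density of the product of two independent positive variables with
    densities [phi] and [f]. *)
Definition mellin_conv (u : R) : \bar R :=
  (\int[mu]_(v in pos) (v^-1 * phi (u / v) * f v)%:E)%E.

Let expRNln (v : R) : 0 < v -> expR (- ln v) = v^-1.
Proof. by move=> v0; rewrite expRN lnK. Qed.

Let patch_mellin (B : set RL) (u : R) :
  ((mellin_conv : RL -> \bar R) \_ (B `&` pos)) u = (\int[mu]_v K B (u, v))%E.
Proof.
rewrite patchE; case: ifPn => uB; last first.
  by rewrite integral0_eq// => v _; rewrite /K/= indicE (negbTE uB) mul0r.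
rewrite /mellin_conv integral_mkcond; apply: eq_integral => v _.
rewrite patchE /K/= indicE uB mul1r [\1_pos v]indicE.
case: ifPn => [/set_mem|_]; last by rewrite mul0r.
by rewrite /= in_itv/= andbT => v0; rewrite mul1r expRNln.
Qed.

Lemma mellin_conv_ge0 u : (0 <= mellin_conv u)%E.
Proof.
apply: integral_ge0 => v; rewrite /= in_itv/= andbT => v0.
by rewrite lee_fin !mulr_ge0// invr_ge0 ltW.
Qed.

Lemma measurable_mellin_conv : measurable_fun pos mellin_conv.
Proof.
have := @measurable_fun_fubini_tonelli_F _ _ _ _ _ mu _
  (mK measurableT) (@K0 setT).
move=> /measurable_funTS m; apply: eq_measurable_fun (m pos) => u upos.
by rewrite /fubini_F -patch_mellin patchE setTI upos.
Qed.

(** Tonelli exchanges the integrals; the inner integral over [u] of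
    [v^-1 phi(u / v)] is then, by the substitution [u = x v], the mass that
    [phi] gives to the set of [x] such that [x v] is in [B]. *)
Lemma integral_mellin_conv (B : set RL) : measurable B ->
  (\int[mu]_(u in B `&` pos) mellin_conv u =
   \int[mu]_(v in pos) ((f v)%:E *
     \int[mu]_(x in [set x | B (x * v)%R] `&` pos) (phi x)%:E))%E.
Proof.
move=> mB; rewrite integral_mkcond.
under eq_integral do rewrite patch_mellin.
rewrite (fubini_tonelli (K B) (mK mB) (@K0 B)) [RHS]integral_mkcond.
apply: eq_integral => v _; rewrite patchE; case: ifPn => vpos; last first.
  rewrite integral0_eq// => u _.
  by rewrite /K/= [X in _ * (X * _)]indicE (negbTE vpos) mul0r mulr0.
have := set_mem vpos; rewrite /= in_itv/= andbT => v0.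
have mBp : measurable (B `&` pos) by exact: measurableI.
pose h (u : R) := (phi (u * v^-1))%:E.
have mh : measurable_fun (B `&` pos) h.
  apply/measurable_EFinP; apply: measurable_funTS.
  apply: measurableT_comp => //.
  exact: measurable_funM.
have h0 u : (0 <= h u)%E by rewrite lee_fin.
transitivity (\int[mu]_(u in B `&` pos) ((v^-1 * f v)%:E * h u))%E.
  rewrite [RHS]integral_mkcond; apply: eq_integral => u _.
  rewrite patchE /K/= !indicE vpos mul1r expRNln//.
  case: ifPn => uB; last by rewrite mul0r.
  by rewrite mul1r -EFinM; congr EFin; ring.
rewrite ge0_integralZl_EFin//; last by rewrite mulr_ge0// invr_ge0 ltW.
rewrite (ge0_integral_scale v0)// muleA -EFinM mulrAC mulVf ?gt_eqF// mul1r.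
congr (_ * _)%E.
have -> : [set x | (B `&` pos) (x * v)%R] = [set x | B (x * v)%R] `&` pos.
  by apply/seteqP; split => x /=; rewrite !in_itv/= !andbT pmulr_lgt0.
by apply: eq_integral => x _; rewrite /h mulfK// gt_eqF.
Qed.

End MellinConvolution.

(** * Integrability of the beta kernel *)

Section BetaKernel.
Context {R : realType}.
Local Notation mu := (@lebesgue_measure R).
Local Notation RL := (measurableTypeR R).

Let onem : RL -> RL := fun x => 1 - x.

Let measurable_onem : measurable_fun [set: RL] onem.
Proof. by apply: measurable_funB. Qed.

Lemma lebesgue_measure_onem (A : set RL) : measurable A ->
  mu A = pushforward mu onem A.
Proof.
apply: lebesgue_measure_unique => // X [[a b] _ <-] /=.
rewrite /pushforward.
have -> : onem @^-1` `]a, b] = `[(1 - b), (1 - a)[%classic.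
  by apply/seteqP; split => x; rewrite /onem /= !in_itv/= => /andP[? ?];
    apply/andP; split; lra.
rewrite [X in X = _]lebesgue_measure_itv [X in _ = X]lebesgue_measure_itv/=.
rewrite !lte_fin ltrD2l ltrN2.
by case: ifPn => // _; rewrite -!EFinB; congr EFin; ring.
Qed.

Lemma ge0_integral_onem (h : R -> \bar R) :
  measurable_fun (`]0%R, 1%R[ : set R) h ->
  (forall x, `]0%R, 1%R[%classic x -> (0 <= h x)%E) ->
  (\int[mu]_(x in `]0%R, 1%R[) h x = \int[mu]_(x in `]0%R, 1%R[) h (1 - x)%R)%E.
Proof.
move=> mh h0.
transitivity (\int[pushforward mu onem]_(x in `]0%R, 1%R[) h x)%E.
  by apply: eq_measure_integral => // A mA _; exact: lebesgue_measure_onem.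
rewrite ge0_integral_pushforward//; last by move=> u /set_mem; exact: h0.
congr (integral _ _ _).
by apply/seteqP; split => x; rewrite /onem /= !in_itv/= => /andP[]; lra.
Qed.

(** On [(0, 1)] the factor [(1 + x^p)^-2] of [pow_dominator p] is at least
    [1 / 4]. *)
Lemma expR_ln_integrable01 (p : R) : 0 < p ->
  mu.-integrable `]0, 1[ (EFin \o (fun x => expR ((p - 1) * ln x))).
Proof.
move=> p0.
have mp : measurable (`]0, +oo[ : set R) by exact: measurable_itv.
have m1 : measurable (`]0, 1[ : set RL) by exact: measurable_itv.
have iD : mu.-integrable `]0, 1[ (EFin \o pow_dominator p).
  apply: integrableS (pow_dominator_integrable p0) => //.
  by move=> x; rewrite /= !in_itv/= andbT => /andP[].
have := @integrableZl_EFin _ _ _ _ _ m1 (4 / p) _ iD.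
apply: le_integrable => //.
  apply/measurable_EFinP; apply: measurable_funTS.
  by apply: measurableT_comp => //; apply: measurable_funM.
move=> x /=; rewrite in_itv/= => /andP[x0 x1]; rewrite lee_fin.
rewrite ger0_norm ?expR_ge0// (le_trans _ (ler_norm _))//.
rewrite /pow_dominator.
have s0 : 0 < expR (p * ln x) by exact: expR_gt0.
have s1 : expR (p * ln x) <= 1.
  by rewrite -[leRHS]expR0 ler_expR mulr_ge0_le0 ?ln_le0// ltW.
rewrite [leRHS](_ : _ =
  expR ((p - 1) * ln x) * (2 / (1 + expR (p * ln x))) ^+ 2); last first.
  by field; rewrite !gt_eqF// addr_gt0.
rewrite ler_peMr ?expR_ge0// exprn_ege1// ler_pdivlMr ?addr_gt0//; lra.
Qed.

Lemma expR_ln_onem_integrable01 (p : R) : 0 < p ->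
  mu.-integrable `]0, 1[ (EFin \o (fun x => expR ((p - 1) * ln (1 - x)))).
Proof.
move=> p0.
have m1 : measurable (`]0, 1[ : set RL) by exact: measurable_itv.
have /integrableP[mh] := expR_ln_integrable01 p0.
rewrite ge0_integral_onem//; last exact: measurableT_comp.
move=> fin; apply/integrableP; split => //.
apply/measurable_EFinP; apply: measurable_funTS.
apply: measurableT_comp => //; apply: measurable_funM => //.
by apply: measurableT_comp => //; apply: measurable_funB.
Qed.

(** The beta density with parameters [(r + 1, a)], without its normalizing
    constant. *)
Definition beta_kernel (r a : R) : R -> R :=
  (fun x => expR (r * ln x) * expR ((a - 1) * ln (1 - x))) \_ `]0, 1[.

Lemma beta_kernel_ge0 r a x : 0 <= beta_kernel r a x.
Proof.
by rewrite /beta_kernel patchE; case: ifP => // _; rewrite mulr_ge0 ?expR_ge0.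
Qed.

Lemma measurable_beta_kernel r a : measurable_fun [set: R] (beta_kernel r a).
Proof.
have m1 : measurable (`]0, 1[ : set R) by exact: measurable_itv.
apply/(measurable_restrictT _ m1).
apply: measurable_funTS; apply: measurable_funM.
  by apply: measurableT_comp => //; apply: measurable_funM.
apply: measurableT_comp => //; apply: measurable_funM => //.
by apply: measurableT_comp => //; apply: measurable_funB.
Qed.

Let expR_ln_le2 (q x : R) : 1 / 2 <= x -> x <= 1 ->
  expR (q * ln x) <= expR (`|q| * ln 2).
Proof.
move=> x2 x1; rewrite ler_expR (le_trans (ler_norm _))// normrM ler_wpM2l//.
have x0 : 0 < x by lra.
rewrite ler0_norm ?ln_le0// -lnV ?posrE// ler_ln ?posrE ?invr_gt0//.
by rewrite invf_ple ?posrE//; lra.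
Qed.

(** Each of the two factors is bounded on the half of [(0, 1)] where the other
    one may be singular, so the kernel is below a sum of two integrable
    powers. *)
Lemma integral_beta_kernel_lty (r a : R) : -1 < r -> 0 < a ->
  (\int[mu]_(x in `]0%R, +oo[) (beta_kernel r a x)%:E < +oo)%E.
Proof.
move=> r1 a0; have r0 : 0 < r + 1 by lra.
have m1 : measurable (`]0, 1[ : set RL) by exact: measurable_itv.
pose g x := expR (`|a - 1| * ln 2) * expR (r * ln x) +
  expR (`|r| * ln 2) * expR ((a - 1) * ln (1 - x)).
have ig : mu.-integrable `]0, 1[ (EFin \o g).
  apply: integrableD_EFin => //; apply: integrableZl_EFin => //.
    by have := expR_ln_integrable01 r0; rewrite addrK.
  exact: expR_ln_onem_integrable01.
have : mu.-integrable `]0, 1[ (EFin \o beta_kernel r a).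
  apply: le_integrable ig => //.
    apply/measurable_EFinP; apply: measurable_funTS.
    exact: measurable_beta_kernel.
  move=> x /= x01; rewrite lee_fin ger0_norm ?beta_kernel_ge0//.
  rewrite (le_trans _ (ler_norm _))// /beta_kernel patchE mem_set//.
  move: x01; rewrite in_itv/= => /andP[x0 x1].
  have [x2|x2] := leP x (1 / 2).
    rewrite ler_wpDr ?mulr_ge0 ?expR_ge0// mulrC ler_wpM2r ?expR_ge0//.
    by rewrite expR_ln_le2//; lra.
  rewrite ler_wpDl ?mulr_ge0 ?expR_ge0// ler_wpM2r ?expR_ge0//.
  by rewrite expR_ln_le2//; lra.
move=> /integrableP[_]; congr (_ < _)%E.
rewrite integral_mkcond [RHS]integral_mkcond; apply: eq_integral => x _.
rewrite !patchE; case: ifPn => [/set_mem x01|x01].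
  rewrite mem_set; last by move: x01; rewrite /= !in_itv/= andbT => /andP[].
  by rewrite /= ger0_norm// beta_kernel_ge0.
by case: ifP => // _; rewrite /beta_kernel patchE (negbTE x01).
Qed.

End BetaKernel.

(** * Densities and the law of a product *)

Section Density.
Local Open Scope ereal_scope.

(** The density [p] agrees almost everywhere with the Radon-Nikodym derivative,
    for which the change of variables is known. *)
Lemma ge0_integral_density d (T : measurableType d) (R : realType)
    (mu : {sigma_finite_measure set T -> \bar R})
    (nu : {finite_measure set T -> \bar R})
    (p h : T -> \bar R) :
  measurable_fun [set: T] p -> (forall x, 0 <= p x) ->
  (forall A, measurable A -> nu A = \int[mu]_(x in A) p x) ->
  measurable_fun [set: T] h -> (forall x, 0 <= h x) ->
  \int[nu]_x h x = \int[mu]_x (h x * p x).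
Proof.
move=> mp p0 nuE mh h0.
have dom : nu `<< mu.
  apply/null_content_dominatesP => A mA A0.
  by rewrite nuE// null_set_integral//; exact: measurable_funTS.
have irn := Radon_Nikodym_SigmaFinite.f_integrable dom.
have mrn := measurable_int _ irn.
rewrite -(Radon_Nikodym_SigmaFinite.change_of_variables dom)//.
apply: ae_eq_integral => //.
- exact: emeasurable_funM.
- exact: emeasurable_funM.
apply: ae_eqe_mul2l; apply: integral_ae_eq => // E _ mE.
by rewrite -Radon_Nikodym_SigmaFinite.f_integral// nuE.
Qed.

End Density.

Lemma density_patch (R : realType) (p : R -> R) : is_density p ->
  [/\ measurable_fun [set: R] (p \_ (`]0, +oo[ : set R)),
      forall x, 0 <= (p \_ `]0, +oo[) x &
      (\int[lebesgue_measure]_(x in `]0%R, +oo[)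
        ((p \_ `]0, +oo[) x)%:E = 1)%E].
Proof.
move=> [mp p0 p1].
have mpos : measurable (`]0, +oo[ : set R) by exact: measurable_itv.
split; first exact/(measurable_restrictT _ mpos).
- move=> x; rewrite patchE; case: ifPn => // /set_mem.
  by rewrite /= in_itv/= andbT; exact: p0.
- by rewrite -p1; apply: eq_integral => x xpos; rewrite patchE xpos.
Qed.

Section ProductLaw.
Local Open Scope ereal_scope.
Context {R : realType}.
Local Notation mu := (@lebesgue_measure R).
Local Notation RL := (measurableTypeR R).
Local Notation pos := (`]0%R, +oo[%classic : set RL).
Context d (T : measurableType d) (P : probability T R).

(** By independence the joint law is the product of the laws; slicing the event
    at a value [y] of [X2] leaves the event that [X1] times [y] is in [B], and
    [integral_mellin_conv] recognizes the resulting iterated integral.  The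
    codomain is the copy of the line whose sigma-algebra is generated by
    half-open intervals: Lebesgue measure is defined on that copy. *)
Lemma product_law (X1 X2 : {mfun T >-> RL}) (p1 p2 : R -> R) :
  measurable_fun [set: R] p1 -> measurable_fun [set: R] p2 ->
  (forall x, (0 <= p1 x)%R) -> (forall x, (0 <= p2 x)%R) ->
  (forall A B : set RL, measurable A -> measurable B ->
    P (X1 @^-1` A `&` X2 @^-1` B) = P (X1 @^-1` A) * P (X2 @^-1` B)) ->
  (forall A : set RL, measurable A ->
    P (X1 @^-1` A) = \int[mu]_(x in A `&` pos) (p1 x)%:E) ->
  (forall A : set RL, measurable A ->
    P (X2 @^-1` A) = \int[mu]_(x in A `&` pos) (p2 x)%:E) ->
  forall B : set RL, measurable B ->
  P [set w | B (X1 w * X2 w)%R] = \int[mu]_(u in B `&` pos) mellin_conv p1 p2 u.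
Proof.
move=> mp1 mp2 p10 p20 ind law1 law2 B mB.
pose S : set (RL * RL) := [set z | B (z.2 * z.1)%R].
have mS : measurable S.
  have mm : measurable_fun [set: RL * RL] (fun z => z.2 * z.1 : RL)%R.
    exact: measurable_funM.
  by rewrite -[S]setTI; exact: mm.
pose Z (w : T) : RL * RL := (X2 w, X1 w).
have mZ : measurable_fun [set: T] Z by exact: measurable_fun_pair.
pose Zm : {mfun T >-> (RL * RL)%type} :=
  HB.pack Z (isMeasurableFun.Build _ _ _ _ _ mZ).
have law : (distribution P X2 \x distribution P X1) S = distribution P Zm S.
  apply: product_measure_unique => // A A' mA mA'.
  transitivity (P (X1 @^-1` A' `&` X2 @^-1` A)); last by rewrite ind// muleC.
  by congr (P _); apply/seteqP; split => w [].
transitivity (distribution P Zm S); first by [].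
rewrite -law /product_measure1.
have mh := measurable_fun_xsection (distribution P X1) mS.
rewrite (@ge0_integral_density _ _ _ mu _ ((EFin \o p2) \_ pos)).
- rewrite (integral_mellin_conv mp1 mp2 p10 p20 mB) [RHS]integral_mkcond.
  apply: eq_integral => y _.
  rewrite !patchE; case: ifPn => ypos; last by rewrite mule0.
  rewrite muleC; congr (_ * _).
  rewrite -law1; last first.
    have mm : measurable_fun [set: RL] (fun x => x * y : RL)%R.
      exact: measurable_funM.
    by rewrite -[X in measurable X]setTI; exact: mm.
  congr (P (X1 @^-1` _)).
  by apply/seteqP; split => x; rewrite /xsection /S /= inE.
- have mpos : measurable pos by exact: measurable_itv.
  apply/(measurable_restrictT _ mpos); apply: measurable_funTS.
  exact/measurable_EFinP.
- by move=> x; rewrite patchE; case: ifP => // _; rewrite lee_fin.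
- by move=> A mA; rewrite -integral_mkcondr; exact: law2.
- exact: mh.
- by move=> x; exact: measure_ge0.
Qed.
End ProductLaw.

(** * Integrals of complex-valued functions *)

Section ComplexIntegral.
Context {R : realType}.
Local Notation mu := (@lebesgue_measure R).
Local Notation RL := (measurableTypeR R).
Implicit Types (D E : set RL) (F : R -> R[i]) (k : R[i]).

Lemma cintegrableZ D k F : measurable D -> cintegrable D F ->
  cintegrable D (fun t => k * F t).
Proof.
case: k => a b mD [iRe iIm]; split.
- have : mu.-integrable D
      (EFin \o (fun t => a * complex.Re (F t) - b * complex.Im (F t))).
    by apply: integrableB_EFin => //; exact: integrableZl_EFin.
  by apply: eq_integrable => // t _ /=; case: (F t).
- have : mu.-integrable D
      (EFin \o (fun t => a * complex.Im (F t) + b * complex.Re (F t))).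
    by apply: integrableD_EFin => //; exact: integrableZl_EFin.
  by apply: eq_integrable => // t _ /=; case: (F t).
Qed.

Lemma cintegralZ D k F : measurable D -> cintegrable D F ->
  cintegral D (fun t => k * F t) = k * cintegral D F.
Proof.
case: k => a b mD [iRe iIm]; rewrite /cintegral; simpc.
congr (_ +i* _).
- transitivity (\int[mu]_(t in D)
      (a * complex.Re (F t) - b * complex.Im (F t))).
    by apply: eq_Rintegral => t _ /=; case: (F t).
  rewrite RintegralB//; [|exact: integrableZl_EFin|exact: integrableZl_EFin].
  by rewrite !RintegralZl.
- transitivity (\int[mu]_(t in D)
      (a * complex.Im (F t) + b * complex.Re (F t))).
    by apply: eq_Rintegral => t _ /=; case: (F t).
  rewrite RintegralD//; [|exact: integrableZl_EFin|exact: integrableZl_EFin].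
  by rewrite !RintegralZl.
Qed.

Let patch_subset D E (h : RL -> R) : D `<=` E ->
  (forall t, E t -> ~ D t -> h t = 0) ->
  (EFin \o h) \_ D = (EFin \o h) \_ E.
Proof.
move=> DE h0; apply/funext => t; rewrite !patchE.
case: ifPn => tD; first by rewrite mem_set//; apply: DE; exact: set_mem.
case: ifPn => // /set_mem tE; rewrite /= h0//.
by move/negP: tD; apply: contra_not; exact: mem_set.
Qed.

Lemma cintegrable_patch D E F : measurable D -> measurable E -> D `<=` E ->
  (forall t, E t -> ~ D t -> F t = 0) -> cintegrable D F -> cintegrable E F.
Proof.
move=> mD mE DE F0 [iRe iIm]; split.
- apply/(integrable_mkcond _ mE); move/(integrable_mkcond _ mD) : iRe.
  rewrite (patch_subset (h := fun t => complex.Re (F t)) DE)//.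
  by move=> t Et /F0 ->.
- apply/(integrable_mkcond _ mE); move/(integrable_mkcond _ mD) : iIm.
  rewrite (patch_subset (h := fun t => complex.Im (F t)) DE)//.
  by move=> t Et /F0 ->.
Qed.

Lemma cintegral_patch D E F : D `<=` E ->
  (forall t, E t -> ~ D t -> F t = 0) -> cintegral E F = cintegral D F.
Proof.
move=> DE F0; rewrite /cintegral /Rintegral; congr (fine _ +i* fine _);
  rewrite integral_mkcond [RHS]integral_mkcond.
- rewrite -(patch_subset (h := fun t => complex.Re (F t)) DE)//.
  by move=> t Et /F0 ->.
- rewrite -(patch_subset (h := fun t => complex.Im (F t)) DE)//.
  by move=> t Et /F0 ->.
Qed.

Lemma eq_cintegrable D F G : measurable D -> {in D, F =1 G} ->
  cintegrable D F -> cintegrable D G.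
Proof.
move=> mD FG [iRe iIm].
by split; [move: iRe|move: iIm]; apply: eq_integrable => // t tD; rewrite FG.
Qed.

Lemma eq_cintegral D F G :
  {in D, F =1 G} -> cintegral D F = cintegral D G.
Proof.
by move=> FG; congr (_ +i* _); apply: eq_Rintegral => t tD; rewrite FG.
Qed.

End ComplexIntegral.

(** * The Kober operator and the product density *)

Section Kober.
Context {R : realType}.
Local Notation mu := (@lebesgue_measure R).
Local Notation RL := (measurableTypeR R).
Local Notation pos := (`]0%R, +oo[%classic : set RL).
Variables (alpha zeta : R[i]) (f : R -> R).
Hypotheses (halpha : 0 < complex.Re alpha) (hzeta : -1 < complex.Re zeta).
Hypothesis hf : is_density f.

Let a := complex.Re alpha.
Let r := complex.Re zeta.

Let f0 := f \_ `]0, +oo[.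

(** The convolution has the integral [B(r + 1, a)], hence is finite almost
    everywhere. *)
Lemma mellin_conv_beta_fin :
  {ae mu, forall u, 0 < u -> mellin_conv (beta_kernel r a) f0 u \is a fin_num}.
Proof.
have [mf0 f00 f01] := density_patch hf.
have mpos : measurable pos by exact: measurable_itv.
have mk := measurable_beta_kernel r a.
have k0 := beta_kernel_ge0 r a.
have mm := measurable_mellin_conv mk mf0 k0 f00.
have im : mu.-integrable pos (mellin_conv (beta_kernel r a) f0).
  apply/integrableP; split => //.
  under eq_integral do rewrite gee0_abs ?mellin_conv_ge0//.
  rewrite -[X in integral _ X]setTI integral_mellin_conv//.
  under eq_integral.
    move=> v _; rewrite (_ : [set x | setT (x * v)] = setT)// setTI. over.
  rewrite ge0_integralZr//=.
  - by rewrite f01 mul1e integral_beta_kernel_lty.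
  - by apply/measurable_EFinP; exact: measurable_funTS.
  - by move=> x _; rewrite lee_fin.
  - by apply: integral_ge0 => x _; rewrite lee_fin.
have := integrable_ae mpos im.
apply: filterS => u; rewrite /= in_itv/= andbT; exact.
Qed.

Let modulus u t :=
  expR ((a - 1) * ln (t - u)) * expR ((- r - a) * ln t) * f t.

Let phase u t := complex.Im alpha * ln (t - u) +
  (- complex.Im zeta - complex.Im alpha) * ln t.

Let kober_integrandE (u t : R) : kober_integrand zeta alpha f u t =
  (modulus u t * cos (phase u t)) +i* (modulus u t * sin (phase u t)).
Proof.
rewrite /kober_integrand !cpowE /modulus /phase /a /r.
case: alpha => a1 a2; case: zeta => z1 z2.
by simpc; rewrite /= ?subr0 cosD sinD; congr (_ +i* _); ring.
Qed.

Let measurable_kober_integrand u : 0 < u ->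
  measurable_fun (`]u, +oo[ : set R)
    (fun t => complex.Re (kober_integrand zeta alpha f u t)) /\
  measurable_fun (`]u, +oo[ : set R)
    (fun t => complex.Im (kober_integrand zeta alpha f u t)).
Proof.
move=> u0.
have mfu : measurable_fun (`]u, +oo[ : set R) f.
  case: hf => mf _ _; apply: measurable_funS mf => //.
  by move=> t; rewrite /= !in_itv/= !andbT; exact: lt_trans.
have ml q : measurable_fun [set: R] (fun t : R => q * ln t).
  by apply: measurable_funM => //; exact: measurable_ln.
have mlu q : measurable_fun [set: R] (fun t : R => q * ln (t - u)).
  apply: measurable_funM => //; apply: measurableT_comp.
    exact: measurable_ln.
  exact: measurable_funB.
have mE : measurable_fun (`]u, +oo[ : set R) (modulus u).
  apply: measurable_funM => //; apply: measurable_funTS.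
  by apply: measurable_funM; exact: measurableT_comp.
have mA : measurable_fun [set: R] (phase u) by exact: measurable_funD.
split.
- have -> : (fun t => complex.Re (kober_integrand zeta alpha f u t)) =
      (fun t => modulus u t * cos (phase u t)).
    by apply/funext => t; rewrite kober_integrandE.
  apply: measurable_funM => //; apply: measurable_funTS.
  apply: (measurableT_comp (f := cos)) => //.
  by apply: continuous_measurable_fun; exact: continuous_cos.
- have -> : (fun t => complex.Im (kober_integrand zeta alpha f u t)) =
      (fun t => modulus u t * sin (phase u t)).
    by apply/funext => t; rewrite kober_integrandE.
  apply: measurable_funM => //; apply: measurable_funTS.
  apply: (measurableT_comp (f := sin)) => //.
  by apply: continuous_measurable_fun; exact: continuous_sin.
Qed.

(** The modulus of the Kober integrand is [u^(-r)] times the integrand of the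
    convolution. *)
Lemma kober_integrand_cintegrable u : 0 < u ->
  mellin_conv (beta_kernel r a) f0 u \is a fin_num ->
  cintegrable `]u, +oo[ (kober_integrand zeta alpha f u).
Proof.
move=> u0 fin; have [mRe mIm] := measurable_kober_integrand u0.
have [mf0 f00 f01] := density_patch hf.
have mD : measurable (`]u, +oo[ : set RL) by exact: measurable_itv.
have mpos : measurable pos by exact: measurable_itv.
pose N t := expR (- r * ln u) * (t^-1 * beta_kernel r a (u / t) * f0 t).
have iN : mu.-integrable `]u, +oo[ (EFin \o N).
  apply: integrableZl_EFin => //.
  apply: (@integrableS _ _ _ _ pos) => //.
    by move=> t; rewrite /= !in_itv/= !andbT; exact: lt_trans.
  apply/integrableP; split.
    apply/measurable_EFinP.
    have mi : measurable_fun [set: R] (fun t : R => expR (- ln t)).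
      by apply: measurableT_comp => //; apply: measurableT_comp.
    apply: (eq_measurable_fun (fun t =>
        expR (- ln t) * beta_kernel r a (u * expR (- ln t)) * f0 t)).
      by move=> t /set_mem; rewrite /= in_itv/= andbT => t0; rewrite expRN lnK.
    apply: measurable_funTS; apply: measurable_funM => //.
    apply: measurable_funM => //; apply: measurableT_comp.
      exact: measurable_beta_kernel.
    exact: measurable_funM.
  under eq_integral.
    move=> t /set_mem; rewrite /= in_itv/= andbT => t0.
    rewrite ger0_norm; last first.
      by rewrite !mulr_ge0 ?beta_kernel_ge0// invr_ge0 ltW.
    over.
  rewrite -ge0_fin_numE ?fin// mellin_conv_ge0// => x.
  exact: beta_kernel_ge0.
have NE t : u < t -> N t = modulus u t.
  move=> ut; have t0 := lt_trans u0 ut.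
  rewrite /N /modulus /beta_kernel /f0 !patchE.
  rewrite !mem_set/= ?in_itv/= ?andbT//; last first.
    by rewrite divr_gt0//= ltr_pdivrMr// mul1r.
  have -> : 1 - u / t = (t - u) / t by field; rewrite gt_eqF.
  rewrite !ln_div ?posrE// ?subr_gt0//.
  rewrite -[in t^-1](lnK t0) -expRN !mulrA; congr (_ * _).
  by rewrite -!expRD; congr expR; ring.
split.
- apply: le_integrable iN => //; first exact/measurable_EFinP.
  move=> t tu; have ut : u < t by move: tu; rewrite /= in_itv/= andbT.
  change (`|complex.Re (kober_integrand zeta alpha f u t)|%:E <= `|N t|%:E)%E.
  rewrite lee_fin NE// kober_integrandE/=.
  by rewrite normrM ler_piMr// cos_max.
- apply: le_integrable iN => //; first exact/measurable_EFinP.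
  move=> t tu; have ut : u < t by move: tu; rewrite /= in_itv/= andbT.
  change (`|complex.Im (kober_integrand zeta alpha f u t)|%:E <= `|N t|%:E)%E.
  rewrite lee_fin NE// kober_integrandE/=.
  by rewrite normrM ler_piMr// sin_max.
Qed.

End Kober.

Section ProductDensity.
Context {R : realType}.
Local Notation mu := (@lebesgue_measure R).
Local Notation RL := (measurableTypeR R).
Local Notation pos := (`]0%R, +oo[%classic : set RL).
Variables (alpha zeta : R[i]) (f : R -> R).

Definition beta1_constant : R[i] :=
  cGamma (zeta + 1 + alpha) / (cGamma (zeta + 1) * cGamma alpha).

Lemma product_integrandE u v : 0 < u -> u < v ->
  product_integrand zeta alpha f u v =
  beta1_constant * cpow u zeta * kober_integrand zeta alpha f u v.
Proof.
move=> u0 uv; have v0 := lt_trans u0 uv.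
rewrite /product_integrand /beta1_density ifT; last first.
  by rewrite divr_gt0//= ltr_pdivrMr// mul1r.
rewrite -/beta1_constant /kober_integrand.
have -> : 1 - u / v = (v - u) / v by field; rewrite gt_eqF.
rewrite !cpowM ?invr_gt0 ?subr_gt0// !cpowV// -!cpowN.
have -> : (v^-1)%:C = cpow v (- 1) by rewrite cpowN cpow1// fmorphV.
have -> : - zeta - alpha = - 1 + - zeta + - (alpha - 1) by ring.
rewrite !cpowD; ring.
Qed.

Lemma product_integrand_eq0 u v : 0 < v -> v <= u ->
  product_integrand zeta alpha f u v = 0.
Proof.
move=> v0 vu; rewrite /product_integrand /beta1_density ifF ?mulr0 ?mul0r//.
by apply/negP => /andP[_]; rewrite ltr_pdivrMr// mul1r ltNge vu.
Qed.

Lemma product_density_kober u : 0 < u ->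
  cintegrable `]u, +oo[ (kober_integrand zeta alpha f u) ->
  cintegrable `]0, +oo[ (product_integrand zeta alpha f u) /\
  product_density zeta alpha f u =
    beta1_constant * cpow u zeta *
    cintegral `]u, +oo[ (kober_integrand zeta alpha f u).
Proof.
move=> u0 ik.
have mD : measurable (`]u, +oo[ : set RL) by exact: measurable_itv.
have mpos : measurable pos by exact: measurable_itv.
have Dpos : (`]u, +oo[ : set RL) `<=` pos.
  by move=> t; rewrite /= !in_itv/= !andbT; exact: lt_trans.
have off v : pos v -> ~ (`]u, +oo[%classic v) ->
    product_integrand zeta alpha f u v = 0.
  rewrite /= !in_itv/= !andbT => v0 /negP; rewrite -leNgt.
  exact: product_integrand_eq0.
have on : {in (`]u, +oo[%classic : set RL),
    (fun v => beta1_constant * cpow u zeta * kober_integrand zeta alpha f u v)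
    =1 product_integrand zeta alpha f u}.
  move=> v /set_mem; rewrite /= in_itv/= andbT => uv.
  by rewrite product_integrandE.
split.
  apply: (cintegrable_patch mD mpos Dpos off).
  by apply: (eq_cintegrable mD on); exact: cintegrableZ.
rewrite /product_density (cintegral_patch Dpos off) -(eq_cintegral on).
by rewrite cintegralZ.
Qed.

Hypotheses (halpha : 0 < complex.Re alpha) (hzeta : -1 < complex.Re zeta).

(** Here the non-vanishing of Gamma enters: were [Gamma(zeta + 1 + alpha)] zero,
    the product density would vanish identically, while the Kober operator
    need not. *)
Lemma kober_product_density u : 0 < u ->
  cintegrable `]u, +oo[ (kober_integrand zeta alpha f u) ->
  kober zeta alpha f u =
  cGamma (zeta + 1) / cGamma (zeta + 1 + alpha) *
  product_density zeta alpha f u.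
Proof.
move=> u0 ik; have [_ ->] := product_density_kober u0 ik.
have ga : cGamma alpha != 0 by exact: cGamma_neq0.
have gz : cGamma (zeta + 1) != 0.
  by apply: cGamma_neq0; move: hzeta; case: zeta => ? ? /=; lra.
have gza : cGamma (zeta + 1 + alpha) != 0.
  apply: cGamma_neq0; move: hzeta halpha.
  by case: zeta => ? ?; case: alpha => ? ? /=; lra.
rewrite /kober /beta1_constant; field.
by rewrite ga gz gza.
Qed.

End ProductDensity.

(** * Real parameters *)

Section RealParameters.
Context {R : realType}.

Lemma real_complexE (z : R[i]) : complex.Im z = 0 -> z = (complex.Re z)%:C.
Proof. by case: z => x y /= ->. Qed.

Lemma cpow_real (t x : R) : cpow t x%:C = (expR (x * ln t))%:C.
Proof. by rewrite cpowE /= mul0r cos0 sin0 mulr1 mulr0. Qed.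

Lemma cGamma_real (x : R) : cGamma x%:C = (gamma_phase_int x 0 0)%:C.
Proof.
rewrite cGammaE /=; congr (_ +i* _); rewrite /gamma_phase_int.
rewrite /Rintegral integral0_eq// => t _.
by rewrite /gamma_phase mul0r add0r cosN cos_pihalf mulr0.
Qed.

Variables (alpha zeta : R[i]).
Hypotheses (Ia : complex.Im alpha = 0) (Iz : complex.Im zeta = 0).

Lemma beta1_density_real (x : R) : beta1_density zeta alpha x =
  (complex.Re (beta1_density zeta alpha x))%:C.
Proof.
rewrite /beta1_density; case: ifP => // _.
rewrite (real_complexE Ia) (real_complexE Iz).
have -> : (complex.Re zeta)%:C + 1 = (complex.Re zeta + 1)%:C :> R[i].
  by rewrite rmorphD rmorph1.
have -> : (complex.Re alpha)%:C - 1 = (complex.Re alpha - 1)%:C :> R[i].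
  by rewrite rmorphB rmorph1.
by rewrite -rmorphD !cGamma_real !cpow_real -rmorphM -fmorphV -!rmorphM.
Qed.

End RealParameters.

Section ProductRV.
Context {R : realType}.
Local Notation mu := (@lebesgue_measure R).
Local Notation RL := (measurableTypeR R).
Local Notation pos := (`]0%R, +oo[%classic : set RL).

Lemma product_density_real (alpha zeta : R[i]) (f : R -> R) u :
  complex.Im alpha = 0 -> complex.Im zeta = 0 -> 0 < u ->
  product_density zeta alpha f u =
  (fine (mellin_conv
    ((fun x => complex.Re (beta1_density zeta alpha x)) \_ `]0, +oo[)
    (f \_ `]0, +oo[) u))%:C.
Proof.
move=> Ia Iz u0.
have E v : product_integrand zeta alpha f u v =
    (v^-1 * complex.Re (beta1_density zeta alpha (u / v)) * f v)%:C.
  by rewrite /product_integrand beta1_density_real// -!rmorphM.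
rewrite /product_density /cintegral; congr (_ +i* _).
  rewrite /Rintegral /mellin_conv; congr fine; apply: eq_integral => v vpos.
  rewrite E/= !patchE vpos ifT//.
  move: vpos => /set_mem; rewrite /= in_itv/= andbT => v0.
  by rewrite mem_set//= in_itv/= andbT divr_gt0.
by rewrite /Rintegral integral0_eq// => v _; rewrite E.
Qed.

(** Both [g] and the convolution integrate to the law of the product over every
    Borel subset of the half-line. *)
Lemma density_product_ae d (T : measurableType d) (P : probability T R)
    (X1 X2 : {RV P >-> R}) (p1 p2 g : R -> R) :
  independent_rv P X1 X2 -> has_density P X1 p1 -> has_density P X2 p2 ->
  has_density P (fun w => X1 w * X2 w) g ->
  {ae mu, forall u, 0 < u ->
    mellin_conv (p1 \_ `]0, +oo[) (p2 \_ `]0, +oo[) u = (g u)%:E}.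
Proof.
move=> ind [dp1 law1] [dp2 law2] [[mg g0 g1] lawg].
have [mp1 p10 _] := density_patch dp1.
have [mp2 p20 _] := density_patch dp2.
have mpos : measurable pos by exact: measurable_itv.
(* the same variables, with values in the copy [RL] of the line that carries
   Lebesgue measure *)
have mX1 : measurable_fun [set: T] (X1 : T -> RL).
  exact: (measurable_funPT X1).
have mX2 : measurable_fun [set: T] (X2 : T -> RL).
  exact: (measurable_funPT X2).
pose Y1 : {mfun T >-> RL} :=
  HB.pack (X1 : T -> RL) (isMeasurableFun.Build _ _ _ _ _ mX1).
pose Y2 : {mfun T >-> RL} :=
  HB.pack (X2 : T -> RL) (isMeasurableFun.Build _ _ _ _ _ mX2).
pose q1 := p1 \_ (`]0%R, +oo[ : set R); pose q2 := p2 \_ (`]0%R, +oo[ : set R).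
have patch_law (p : R -> R) (A : set RL) : (\int[mu]_(x in A `&` pos) (p x)%:E =
    \int[mu]_(x in A `&` pos) ((p \_ `]0%R, +oo[) x)%:E)%E.
  by apply: eq_integral => x /set_mem[_ xpos]; rewrite patchE mem_set.
have law (B : set RL) : measurable B -> (\int[mu]_(u in B `&` pos) (g u)%:E =
    \int[mu]_(u in B `&` pos) mellin_conv q1 q2 u)%E.
  move=> mB; rewrite -lawg//.
  apply: (product_law (X1 := Y1) (X2 := Y2) mp1 mp2 p10 p20) => //.
  - by move=> A mA; rewrite -patch_law -law1.
  - by move=> A mA; rewrite -patch_law -law2.
have mm := measurable_mellin_conv mp1 mp2 p10 p20.
have ig : mu.-integrable pos (EFin \o g).
  apply/integrableP; split; first exact/measurable_EFinP.
  under eq_integral.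
    move=> x /set_mem; rewrite /= in_itv/= andbT => x0.
    rewrite ger0_norm ?g0//. over.
  by rewrite g1 ltry.
have : ae_eq mu pos (EFin \o g) (mellin_conv q1 q2).
  by apply: integral_ae_eq => // E Epos mE; have := law _ mE; rewrite setIidl.
apply: filterS => u H u0; apply/esym/H.
by rewrite /= in_itv/= andbT.
Qed.

End ProductRV.

Theorem theorem1p1 (R : realType) (alpha zeta : R[i]) (f : R -> R)
    (halpha : 0 < complex.Re alpha) (hzeta : -1 < complex.Re zeta)
    (hf : is_density f) :
  exists c : R[i],
    (* arbitrary complex parameters: the density of the product is the function
       given by the usual formula *)
    {ae @lebesgue_measure R, forall u : R, 0 < u ->
       [/\ cintegrable `]u, +oo[ (kober_integrand zeta alpha f u),
           cintegrable `]0, +oo[ (product_integrand zeta alpha f u) &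
           kober zeta alpha f u = c * product_density zeta alpha f u]} /\
    (* real parameters: any density of the product of independent random
       variables *)
    (complex.Im alpha = 0 -> complex.Im zeta = 0 ->
     forall (d : measure_display) (T : measurableType d) (P : probability T R)
       (X1 X2 : {RV P >-> R}) (g : R -> R),
       independent_rv P X1 X2 ->
       has_density P X1 (fun x => complex.Re (beta1_density zeta alpha x)) ->
       has_density P X2 f ->
       has_density P (fun w => X1 w * X2 w) g ->
       {ae @lebesgue_measure R, forall u : R, 0 < u ->
          kober zeta alpha f u = c * (g u)%:C}).
Proof.
exists (cGamma (zeta + 1) / cGamma (zeta + 1 + alpha)).
have aeF : Filter (nbhs (almost_everywhere (@lebesgue_measure R))).
  exact: (@ae_filter_ringOfSetsType _ (measurableTypeR R)).
have main := mellin_conv_beta_fin halpha hzeta hf.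
have intk : {ae @lebesgue_measure R, forall u : R, 0 < u ->
    cintegrable `]u, +oo[ (kober_integrand zeta alpha f u)}.
  move: main; apply: filterS => u fin u0.
  by apply: kober_integrand_cintegrable => //; exact: fin.
split.
  move: (intk); apply: filterS => u ik u0; split; first exact: ik.
  - by have [] := product_density_kober u0 (ik u0).
  - by apply: (kober_product_density halpha hzeta u0); exact: ik.
move=> Ia Iz d T P X1 X2 g ind d1 d2 dg.
have gE := density_product_ae ind d1 d2 dg.
move: intk gE; apply: filterS2 => u ik gu u0.
rewrite (kober_product_density halpha hzeta u0 (ik u0)).
by rewrite (product_density_real f Ia Iz u0) gu.
Qed.
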